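(* Let $\theta^*>0$ be fixed, and let $Z_j\sim\mathrm{Po}(j^{-1}\theta^* )$, $j\ge1$, be independent Poisson random variables. For integers $0\le a<n$ set $T_{an}:=\sum_{j=a+1}^n jZ_j$. If $\theta^*\ne1$, then $$ d_{\mathrm{TV}}\bigl(\mathcal L(T_{an}),\mathcal L(T_{an}+1)\bigr)=O\Bigl(\Bigl\{\frac{a+1}{n}\Bigr\}^{\theta^*}+n^{-1}\Bigr); $$ if $\theta^*=1$, then $$ d_{\mathrm{TV}}\bigl(\mathcal L(T_{an}),\mathcal L(T_{an}+1)\bigr)=O\Bigl(\frac{a+1}{n}+n^{-1}\log\Bigl\{\frac{n}{a+1}\Bigr\}\Bigr). $$ Here the implied constants depend only on $\theta^*$, and the bounds hold uniformly over all integers $0\le a<n$.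
   Context: $\mathcal L(X)$ denotes the distribution of a random variable $X$. For integer-valued random variables $X,Y$, $d_{\mathrm{TV}}(\mathcal L(X),\mathcal L(Y))=\sup_{A\subseteq\mathbb Z}|\mathbb P[X\in A]-\mathbb P[Y\in A]|$ is the total variation distance. $\mathrm{Po}(\lambda)$ is the Poisson distribution with mean $\lambda$. *)

(* Defs.v *)
From HB Require Import structures.
From mathcomp Require Import all_boot all_order all_algebra.
From mathcomp Require Import finmap.
From mathcomp Require Import all_classical all_reals all_analysis.

Set Implicit Arguments.
Unset Strict Implicit.
Unset Printing Implicit Defensive.

Import Order.TTheory GRing.Theory Num.Theory.
Import numFieldNormedType.Exports.

Local Open Scope classical_set_scope.
Local Open Scope ring_scope.

HB.instance Definition _ := isPointed.Build int (Posz 0).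

(* Every set of integers is an event, as for [nat] in the library. *)
HB.instance Definition _ := @isMeasurable.Build default_measure_display
  int discrete_measurable discrete_measurable0
  discrete_measurableC discrete_measurableU.

(* The law of [X] is Po(rate).  [poisson_prob] takes a [nat] argument that its
   body ignores; it is set to 0. *)
Definition poisson_rv d (T : measurableType d) (R : realType)
    (P : probability T R) (X : {RV P >-> nat}) (rate : R) : Prop :=
  forall A : set nat, distribution P X A = poisson_prob rate 0%N A.

(* Mutual independence of the subfamily [X i], [i \in D]. *)
Definition independent_RVs d d' (T : measurableType d)
    (T' : measurableType d') (R : realType) (P : probability T R)
    (I : choiceType) (D : set I) (X : I -> {RV P >-> T'}) : Prop :=
  forall (J : {fset I}) (A : I -> set T'),
    [set` J] `<=` D -> (forall i, measurable (A i)) ->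
    P (\bigcap_(i in [set` J]) (X i @^-1` A i))
      = (\prod_(i <- J) P (X i @^-1` A i))%E.

Definition dTV (R : realType) (mu nu : probability int R) : R :=
  sup [set `|fine (mu A) - fine (nu A)| | A in [set: set int]].

Section integer_random_variables.
Context d (T : measurableType d).

Lemma measurable_nat_int (f : T -> nat) (g : nat -> int) :
  measurable_fun setT f -> measurable_fun setT (g \o f).
Proof. by move=> mf; exact: measurableT_comp. Qed.

Lemma measurable_addz (f g : T -> int) :
  measurable_fun setT f -> measurable_fun setT g ->
  measurable_fun setT (fun x => f x + g x).
Proof.
move=> mf mg _ A _; rewrite setTI.
rewrite (_ : _ @^-1` A = \bigcup_(p : int * int)
    (if `[< A (p.1 + p.2) >] then f @^-1` [set p.1] `&` g @^-1` [set p.2]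
     else set0)).
  apply: countable_bigcupT_measurable => // p; case: ifPn => // _.
  apply: measurableI; rewrite -[X in measurable X]setTI.
    exact: mf.
  exact: mg.
apply/seteqP; split=> [x Ax|x [p _]].
  by exists (f x, g x) => //=; rewrite asboolT.
by case: ifPn => // /asboolP + [/= -> ->].
Qed.

Definition weighted_sum (Z : nat -> {mfun T >-> nat}) (a n : nat) : T -> int :=
  fun x => \sum_(a.+1 <= j < n.+1) (j * Z j x)%N%:Z.

Lemma measurable_weighted_sum Z a n : measurable_fun setT (weighted_sum Z a n).
Proof.
rewrite /weighted_sum; elim: (index_iota _ _) => [|j s ih].
  by under eq_fun do rewrite big_nil; exact: measurable_cst.
under eq_fun do rewrite big_cons.
apply: measurable_addz => //.
by apply: (@measurable_nat_int (Z j) (fun k => (j * k)%N%:Z)).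
Qed.

HB.instance Definition _ Z a n :=
  isMeasurableFun.Build _ _ _ _ (weighted_sum Z a n)
    (measurable_weighted_sum Z a n).

Definition shift1 (X : T -> int) : T -> int := fun x => X x + 1.

Lemma measurable_shift1 (X : {mfun T >-> int}) :
  measurable_fun setT (shift1 X).
Proof. exact: measurable_addz. Qed.

HB.instance Definition _ (X : {mfun T >-> int}) :=
  isMeasurableFun.Build _ _ _ _ (shift1 X) (measurable_shift1 X).

End integer_random_variables.

(* Main.v *)
(* Let p k = P[T_{an} = k].  Size-biasing the Poisson variables gives Stein's
   recursion k p_k = theta (p_{k-a-1} + ... + p_{k-n}), and subtracting it at
   k and k - 1,
     k (p_k - p_{k-1}) = theta p_{k-a-1} - theta p_{k-n-1} - p_{k-1}.
   Hence sum_k |p_k - p_{k-1}|, which dominates the total variation distance,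
   is at most a multiple of p_0 + sum_{a < k <= n} p_k / k + 1 / n.  For
   a <= x <= n, the event T_{an} <= x forces Z_j = 0 for x < j <= n, so it has
   probability at most ((x + 1) / (n + 1))^theta.  This bounds p_0, and then,
   through the recursion, p_k by theta / k (k / n)^theta for a < k <= n; what
   remains is the sum of k^(theta - 2) over a < k <= n, and theta = 1 is the
   case where that sum is logarithmic. *)
Require Import Defs.
From mathcomp Require Import all_boot all_order all_algebra.
From mathcomp Require Import finmap zify ring lra.
From mathcomp Require Import all_classical all_reals all_analysis.

Set Implicit Arguments.
Unset Strict Implicit.
Unset Printing Implicit Defensive.

Import Order.TTheory GRing.Theory Num.Theory.
Import numFieldNormedType.Exports.

Local Open Scope classical_set_scope.
Local Open Scope ring_scope.

(** * Stein's recursion and the total variation of increments *)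

Section stein.
Context {R : realType}.
Implicit Types (p g : int -> R) (a n N c : nat) (k : int).

(** Each unit shift brings in a zero on the left and pushes a nonnegative term out on the right. *)
Lemma ler_sum_shift g c N : (forall k, 0 <= g k) ->
  (forall k, k < 0 -> g k = 0) ->
  \sum_(0 <= k < N) g (k%:Z - c%:Z) <= \sum_(0 <= k < N) g k%:Z.
Proof.
move=> g0 gneg; elim: c => [|c ih].
  by under eq_bigr do rewrite subr0.
apply: le_trans ih; case: N => [|N]; first by rewrite !big_nil.
rewrite big_nat_recl// gneg; last by lia.
rewrite add0r big_nat_recr//= -[leLHS]addr0 lerD//.
by apply: ler_sum => i _; rewrite (_ : _ - _ = i%:Z - c%:Z)//; lia.
Qed.

Lemma ler_sum_shift_div p c N : (0 < c)%N -> (forall k, 0 <= p k) ->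
  (forall k, k < 0 -> p k = 0) ->
  \sum_(1 <= k < N) p (k%:Z - c%:Z) / k%:R
    <= p 0 + \sum_(1 <= k < N) p k%:Z / k%:R.
Proof.
move=> c0 p0 pneg.
case: N => [|N]; first by rewrite !big_geq// addr0.
(* The weight is [1] at [k = 0], whence the separate term [p 0]. A shift by [c > 0] only enlarges
   it, as [maxn 1 (k - c) <= k] for [k >= c]. *)
pose g k := p k / (maxn 1 `|k|%N)%:R.
have := @ler_sum_shift g c N.+1; rewrite big_ltn// (@big_ltn _ _ _ 0%N)//.
have -> : g 0 = p 0 by rewrite /g divr1.
move=> shift; apply: le_trans (le_trans (shift _ _) _).
- rewrite -[leLHS]add0r lerD//; first by rewrite /g divr_ge0.
  apply: ler_sum_nat => k /andP[k1 _].
  have [kc|ck] := ltnP k c; first by rewrite /g !pneg ?mul0r//; lia.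
  rewrite /g ler_wpM2l// lef_pV2 ?posrE ?ltr0n ?ler_nat; lia.
- by move=> k; rewrite /g divr_ge0.
- by move=> k k0; rewrite /g pneg// mul0r.
- rewrite lerD2l; apply: ler_sum_nat => k /andP[k1 _].
  by rewrite /g (maxn_idPr _).
Qed.

(* For a compound Poisson law on the integers whose intensity at [j] is
   [theta / j] for [a < j <= n], and which vanishes elsewhere, this recursion
   is Stein's identity. *)
Definition stein_recursion p (theta : R) a n : Prop :=
  forall k, k%:~R * p k = theta * \sum_(a.+1 <= j < n.+1) p (k - j%:Z).

(** The windows of the recursion at [k] and [k - 1] differ only at their ends, so the difference of
    the two sums telescopes. *)
Lemma stein_increment p (theta : R) a n k : (a <= n)%N ->
  stein_recursion p theta a n ->
  k%:~R * (p k - p (k - 1))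
    = theta * p (k - a.+1%:Z) - theta * p (k - n.+1%:Z) - p (k - 1).
Proof.
move=> an rec.
have := rec k; have := rec (k - 1); rewrite intrB mulrBl => h1 h2.
rewrite mulrBr h2 -[k%:~R * p (k - 1)](subrK (1%:~R * p (k - 1))) h1.
rewrite opprD addrA -mulrBr -sumrB.
rewrite (eq_big_nat _ _ (F2 := fun j => - p (k - j.+1%:Z) - - p (k - j%:Z))).
  by rewrite telescope_sumr//; ring.
by move=> j _; rewrite opprK addrC; congr (- p _ + _); lia.
Qed.

(** The window of the recursion lies strictly below [m]; enlarging it to all of [0, ..., m - 1] adds
    nonnegative terms, and negative arguments contribute nothing. *)
Lemma stein_pointwise p (theta : R) a n (m : nat) : 0 <= theta ->
  (forall k, 0 <= p k) -> (forall k, k < 0 -> p k = 0) ->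
  stein_recursion p theta a n -> (0 < m)%N -> (a <= n)%N ->
  m%:R * p m%:Z <= theta * \sum_(0 <= k < m) p k%:Z.
Proof.
move=> th0 p0 pneg rec m0 an; rewrite pmulrn rec ler_wpM2l//.
apply: (@le_trans _ _ (\sum_(1 <= j < (m + n).+1) p (m%:Z - j%:Z))).
  rewrite [leRHS](big_cat_nat _ (n := a.+1))//=; last by lia.
  rewrite [X in _ + X](big_cat_nat _ (n := n.+1))//=; [|lia..].
  by rewrite addrCA lerDl addr_ge0// sumr_ge0.
rewrite (big_cat_nat _ (n := m.+1))//=; try lia.
rewrite [X in _ + X]big_nat [X in _ + X]big1 ?addr0; last first.
  by move=> j jm; rewrite pneg//; lia.
rewrite big_add1 /= big_nat_rev /= big_nat [leRHS]big_nat.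
by apply: ler_sum => j jm; rewrite (_ : _ - _ = j%:Z)//; lia.
Qed.

(* The increment identity divides by [k], and each of its three terms becomes,
   after a shift, a sum of [p j / j]. *)
Lemma stein_total_variation p (theta : R) a n N : 0 <= theta -> (a < n)%N ->
  (forall k, 0 <= p k) -> (forall k, k < 0 -> p k = 0) ->
  (forall N, \sum_(0 <= k < N) p k%:Z <= 1) ->
  stein_recursion p theta a n ->
  \sum_(0 <= k < N) `|p k%:Z - p (k%:Z - 1)|
    <= (2 * theta + 2) *
       (p 0 + \sum_(a.+1 <= k < n.+1) p k%:Z / k%:R + n%:R^-1).
Proof.
move=> th0 an p0 pneg ptot rec.
have n0 : (0 < n)%N by lia.
(* For [0 < k <= a] the whole window of the recursion is negative, so [k * p k = 0]. *)
have van (k : nat) : (0 < k <= a)%N -> p k%:Z = 0.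
  move=> /andP[k0 ka]; have /eqP := rec k%:Z.
  rewrite big_nat big1; last by move=> j ?; rewrite pneg//; lia.
  by rewrite mulr0 -pmulrn mulf_eq0 pnatr_eq0 -(negbK (k == 0%N))
    -lt0n k0 => /eqP.
pose W := \sum_(1 <= k < N) p k%:Z / k%:R.
(* Beyond [n] the weights are below [1 / n] and the total mass is at most [1]. The upper limit
   [n + N] keeps both cut points in range. *)
have WE : W <= \sum_(a.+1 <= k < n.+1) p k%:Z / k%:R + n%:R^-1.
  apply: (@le_trans _ _ (\sum_(1 <= k < (n + N).+1) p k%:Z / k%:R)).
    case: N @W => [|N] W; first by rewrite /W big_geq// sumr_ge0// => i _;
      rewrite divr_ge0.
    rewrite /W (big_cat_nat _ (n := N.+1) (p := (n + N.+1).+1))//=; last by lia.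
    by rewrite lerDl sumr_ge0// => i _; rewrite divr_ge0.
  rewrite (big_cat_nat _ (n := a.+1))//=; last by lia.
  rewrite [X in X + _]big_nat [X in X + _]big1 ?add0r; last first.
    by move=> j jm; rewrite van ?mul0r//; lia.
  rewrite (big_cat_nat _ (n := n.+1))//=; [|lia..].
  rewrite lerD2l.
  apply: (@le_trans _ _ (n%:R^-1 * \sum_(n.+1 <= k < (n + N).+1) p k%:Z)).
    rewrite mulr_sumr; apply: ler_sum_nat => k kn.
    by rewrite mulrC ler_wpM2r// lef_pV2 ?posrE ?ltr0n ?ler_nat; lia.
  rewrite ler_piMr// ?invr_ge0//; apply: le_trans (ptot (n + N).+1).
  rewrite [leRHS](big_cat_nat _ (n := n.+1))//=; last by lia.
  by rewrite lerDr sumr_ge0.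
set S := (_ + _ + _); have W0 : p 0 + W <= S by rewrite /S -addrA lerD2l.
have S0 : p 0 <= S by apply: le_trans W0; rewrite lerDl sumr_ge0// => k _;
  rewrite divr_ge0.
clear WE; case: N @W W0 => [|N] W W0.
  by rewrite big_nil mulr_ge0// ?(le_trans _ S0)// addr_ge0// mulr_ge0.
(* The increment identity says nothing at [k = 0]; that term is exactly [p 0], since
   [p (- 1) = 0]. *)
rewrite big_ltn// sub0r (pneg (- 1))// subr0 (ger0_norm (p0 _)).
have bound c : (0 < c)%N -> \sum_(1 <= k < N.+1) p (k%:Z - c%:Z) / k%:R <= S.
  by move=> c0; apply: le_trans W0; exact: ler_sum_shift_div.
apply: (@le_trans _ _ (S + (theta * S + theta * S + S)));
  last by rewrite le_eqVlt; apply/orP; left; apply/eqP; ring.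
rewrite lerD//.
apply: (@le_trans _ _ (\sum_(1 <= k < N.+1)
    (theta * (p (k%:Z - a.+1%:Z) / k%:R)
     + theta * (p (k%:Z - n.+1%:Z) / k%:R) + p (k%:Z - 1) / k%:R))).
  apply: ler_sum_nat => k /andP[k0 _].
  have k0' : 0 < k%:R :> R by rewrite ltr0n.
  rewrite !mulrA -!mulrDl ler_pdivlMr// mulrC -[X in X * _](gtr0_norm k0')
    -normrM.
  rewrite pmulrn (stein_increment k%:Z (ltnW an) rec).
  rewrite (le_trans (ler_normB _ _))// (ger0_norm (p0 _)) lerD2r.
  by rewrite (le_trans (ler_normB _ _))// !normrM !(ger0_norm (p0 _))
    (ger0_norm th0).
rewrite 2!big_split/= -!mulr_sumr; do 2?apply: lerD; rewrite ?ler_wpM2l//;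
  exact: bound.
Qed.

(** Here [p'] is the law of [X + n.+1 * Y] for independent [X], [Y] with laws [p], [q]. Writing
    [k = (k - n.+1 * i) + n.+1 * i] under the convolution, the first part reproduces the recursion
    for [p], and the second, through the identity for [q], supplies the new term [j = n.+1]. *)
Lemma stein_recursion_convolution p p' (q : nat -> R) theta a n : (a <= n)%N ->
  stein_recursion p theta a n ->
  (forall k N, k < N%:Z ->
    p' k = \sum_(0 <= i < N) p (k - (n.+1 * i)%:Z) * q i) ->
  (forall i, n.+1%:R * (i.+1%:R * q i.+1) = theta * q i) ->
  stein_recursion p' theta a n.+1.
Proof.
move=> an rec conv qS k.
have kN : k < `|k|.+1%:Z by lia.
set N := `|k|.+1 in kN.
(* One spare term: once the vanishing [i = 0] term is dropped, [N] terms remain, enough for the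
   convolution at [k - n.+1]. *)
rewrite (conv k N.+1); last by lia.
rewrite mulr_sumr (eq_bigr (fun i =>
    \sum_(a.+1 <= j < n.+1) theta * (p (k - j%:Z - (n.+1 * i)%:Z) * q i)
    + n.+1%:R * (i%:R * q i) * p (k - (n.+1 * i)%:Z))); last first.
  move=> i _; rewrite -mulr_sumr -mulr_suml [X in theta * (X * _)](eq_bigr
    (fun j : nat => p (k - (n.+1 * i)%:Z - j%:Z))); last first.
    by move=> j _; rewrite addrAC.
  rewrite [X in _ = X + _]mulrA -rec intrB -pmulrn natrM; ring.
rewrite big_split/= exchange_big/= [in X in _ + X]big_nat_recl//.
rewrite mul0r mulr0 mul0r add0r [in RHS]big_nat_recr//= mulrDr mulr_sumr.
congr (_ + _).
  apply: eq_bigr => j _; rewrite -mulr_sumr -conv//; lia.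
rewrite (conv _ N) ?mulr_sumr; last by lia.
apply: eq_bigr => i _; rewrite qS mulrAC -mulrA; congr (_ * (p _ * _)); lia.
Qed.

End stein.

(** * Logarithms, powers and sums of powers *)

Section power_sums.
Context {R : realType}.
Implicit Types (a n k : nat) (s theta : R).

(** Both bounds are [ln (1 + x) <= x], at [x = - 1 / k.+1] and at [x = 1 / k]. *)
Lemma lnS_sub_bounds k : (0 < k)%N ->
  k.+1%:R^-1 <= ln k.+1%:R - ln (k%:R : R) <= k%:R^-1.
Proof.
move=> k0; have k0R : 0 < k%:R :> R by rewrite ltr0n.
have kS : 0 < k.+1%:R :> R by rewrite ltr0n.
rewrite -ln_div ?posrE//; apply/andP; split.
  rewrite -lerN2 -lnV ?posrE ?divr_gt0// invf_div.
  rewrite (_ : _ / _ = 1 + - k.+1%:R^-1); last first.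
    by rewrite -natr1; field; rewrite natr1 pnatr_eq0.
  by apply: le_ln1Dx; rewrite ltrN2 invf_lt1// ltr1n.
rewrite (_ : _ / _ = 1 + k%:R^-1); last by rewrite -natr1; field; rewrite gt_eqF.
by apply: le_ln1Dx; rewrite (lt_trans (ltrN10 _))// invr_gt0.
Qed.

Lemma powR_natE k s : (0 < k)%N -> k%:R `^ s = expR (s * ln k%:R).
Proof. by move=> k0; rewrite /powR pnatr_eq0 gtn_eqF. Qed.

Lemma powR_pred k s : (0 < k)%N -> k%:R `^ (s - 1) = k%:R `^ s / k%:R.
Proof.
move=> k0; rewrite powRB ?powRr1//.
by rewrite pnatr_eq0 gtn_eqF ?implybT.
Qed.

Lemma powR_divM (x y s : R) : 0 <= x -> 0 <= y ->
  (x / y) `^ s = x `^ s / y `^ s.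
Proof.
by move=> x0 y0; rewrite powRM ?invr_ge0// -powR_inv1// powRAC powR_inv1
  ?powR_ge0.
Qed.

(** The exponential is the mass at [0] of Po([theta / k]); the resulting ratios of powers telescope
    over [k]. *)
Lemma expRN_le_powR k theta : (0 < k)%N -> 0 <= theta ->
  expR (- (k%:R^-1 * theta)) * k.+1%:R `^ theta <= k%:R `^ theta.
Proof.
move=> k0 th0; rewrite !powR_natE// -expRD ler_expR mulrC -mulrN -mulrDr.
rewrite ler_wpM2l// addrC lerBlDr -lerBlDl.
by have /andP[] := lnS_sub_bounds k0.
Qed.

(** This is [1 + x <= expR x] at [x = s * (ln j - ln k)], hence valid for either sign of [s] and
    either order of [j] and [k]. *)
Lemma powR_increment s j k : (0 < j)%N -> (0 < k)%N ->
  k%:R `^ s * (s * (ln j%:R - ln k%:R)) <= j%:R `^ s - k%:R `^ s.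
Proof.
move=> j0 k0; rewrite lerBrDr -[X in _ + X]mulr1 -mulrDr.
rewrite [in leRHS]powR_natE// -[ln j%:R in leRHS](subrK (ln k%:R))
  [in leRHS]mulrDr expRD.
by rewrite -powR_natE// [leRHS]mulrC ler_wpM2l ?powR_ge0// addrC expR_ge1Dx.
Qed.

(* The sum is compared with a telescoping sum of [k `^ s]: its main term is
   [n `^ s] for [s > 0] and [a.+1 `^ s] for [s < 0]. *)
Lemma sum_powR_le s : s != 0 -> exists2 C : R, 0 <= C &
  forall a n, (a < n)%N ->
    \sum_(a.+1 <= k < n.+1) k%:R `^ (s - 1) <= C * (a.+1%:R `^ s + n%:R `^ s).
Proof.
rewrite neq_lt => /orP[s0|s0].
  have C0 : 0 <= - s^-1 by rewrite oppr_ge0 invr_le0 ltW.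
  (* The [1] pays for the first term, and [- s^-1] for the telescoping sum of the others, of which
     only the value at [a.+1] is kept. *)
  exists (1 - s^-1) => [|a n an]; first by rewrite addr_ge0.
  rewrite big_ltn// mulrDl mul1r lerD//.
    apply: (@le_trans _ _ (a.+1%:R `^ s)); last by rewrite lerDl powR_ge0.
    by rewrite ler_powR// ?ler1n// lerBlDr lerDl.
  rewrite big_add1/=.
  apply: (@le_trans _ _ (\sum_(a.+1 <= k < n) s^-1 * (k.+1%:R `^ s - k%:R `^ s))).
    apply: ler_sum_nat => k /andP[ak _]; have k0 : (0 < k)%N by lia.
    have /andP[L _] := lnS_sub_bounds k0.
    rewrite powR_pred// [leRHS]mulrC ler_ndivlMr// -lerN2 opprB.
    apply: le_trans (@powR_increment s k k.+1 k0 isT).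
    rewrite -mulrA -mulrN ler_wpM2l ?powR_ge0// mulrC -mulrN ler_wnM2l
      ?(ltW s0)//.
    by rewrite -lerN2 opprK opprB.
  rewrite -mulr_sumr telescope_sumr// -[s^-1 in leLHS]opprK mulNr -mulrN opprB.
  by rewrite ler_wpM2l// lerD2l// (le_trans _ (powR_ge0 _ _)) ?oppr_le0 ?powR_ge0.
exists (2 / s * 2 `^ s) => [|a n an];
  first by rewrite mulr_ge0 ?powR_ge0// divr_ge0// ltW.
apply: (@le_trans _ _ (\sum_(a.+1 <= k < n.+1) 2 / s *
  (k.+1%:R `^ s - k%:R `^ s))).
  apply: ler_sum_nat => k /andP[ak _]; have k0 : (0 < k)%N by lia.
  rewrite powR_pred//.
  have /andP[L _] := lnS_sub_bounds k0.
  apply: (@le_trans _ _ (2 / s * (k%:R `^ s * (s / k.+1%:R)))).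
    rewrite (_ : 2 / s * _ = k%:R `^ s * (2 / k.+1%:R)); last first.
      by field; rewrite nat1r pnatr_eq0 (gt_eqF s0).
    rewrite ler_wpM2l ?powR_ge0// ler_pdivlMr ?ltr0n// mulrC ler_pdivrMr ?ltr0n//.
    by rewrite -natrM ler_nat; lia.
  rewrite ler_wpM2l ?divr_ge0 ?(ltW s0)//.
  apply: le_trans (@powR_increment s k.+1 k isT k0).
  by rewrite !ler_wpM2l ?powR_ge0 ?(ltW s0).
rewrite -mulr_sumr telescope_sumr//; last by lia.
rewrite -[leRHS]mulrA ler_wpM2l ?divr_ge0 ?(ltW s0)//.
apply: (@le_trans _ _ (n.+1%:R `^ s)); first by rewrite gerBl powR_ge0.
apply: (@le_trans _ _ (2 `^ s * n%:R `^ s));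
  last by rewrite ler_wpM2l ?powR_ge0// lerDr powR_ge0.
rewrite -powRM// ge0_ler_powR ?(ltW s0) ?nnegrE//.
by rewrite -natrM ler_nat; lia.
Qed.

Lemma sum_harmonic_le a n : (a < n)%N ->
  \sum_(a.+1 <= k < n.+1) k%:R^-1 <= a.+1%:R^-1 + ln (n%:R / a.+1%:R) :> R.
Proof.
move=> an; rewrite big_ltn// lerD2l big_add1/= ln_div ?posrE ?ltr0n//;
  last by lia.
rewrite -(telescope_sumr (fun k => ln k%:R) an);
  apply: ler_sum_nat => k /andP[ak _].
by have /andP[] := @lnS_sub_bounds k (leq_trans (ltn0Sn _) ak).
Qed.

End power_sums.

(** * Total variation distance from point masses *)

Section laws_on_integers.
Context {R : realType}.

Lemma measure_partition_nat d (T : measurableType d)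
    (mu : {measure set T -> \bar R}) (F : set T) (f : T -> nat) N :
  measurable F -> measurable_fun setT f ->
  mu (F `&` [set x | (f x < N)%N])
    = (\sum_(0 <= i < N) mu (F `&` f @^-1` [set i]))%E.
Proof.
move=> mF mf; have mpre B : measurable (f @^-1` B).
  by rewrite -[X in measurable X]setTI; exact: mf.
elim: N => [|N ih].
  by rewrite big_nil (_ : [set x | _] = set0) ?setI0 ?measure0// -subset0.
rewrite big_nat_recr//= -ih -measureU; last first.
- by rewrite -subset0 => x [[_ /= +] [_ /= fN]]; rewrite fN ltnn.
- by apply: measurableI.
- by apply: measurableI => //; exact: (mpre [set i | (i < N)%N]).
congr (mu _); rewrite -setIUr; congr (_ `&` _).
apply/seteqP; split=> x /=; rewrite ltnS (leq_eqVlt (f x)).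
  by move=> /orP[/eqP|]; [right|left].
by move=> [->|->]; rewrite ?eqxx ?orbT.
Qed.

Lemma measure_int_segment (mu : probability int R) (A : set int) N :
  fine (mu (A `&` [set k : int | 0 <= k] `&` [set k | (`|k| < N)%N]))
    = \sum_(0 <= k < N) (if `[< A k%:Z >] then fine (mu [set k%:Z]) else 0).
Proof.
rewrite measure_partition_nat// -sum_fine; last first.
  by move=> i _; rewrite fin_num_measure.
apply: eq_bigr => i _; case: ifPn => /asboolP Ai.
  congr (fine (mu _)); apply/seteqP; split=> [k /= [[_ k0] ki]|k /= ->];
    last by [].
  by lia.
rewrite (_ : _ `&` _ = set0) ?measure0// -subset0 => k /= [[Ak k0] ki].
by apply: Ai; rewrite (_ : i%:Z = k)//; lia.
Qed.

(** Continuity from below along [0 <= k < N], the negative part being null. *)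
Lemma cvg_measure_int (mu : probability int R) (A : set int) :
  mu [set k | k < 0] = 0%E ->
  (fun N => \sum_(0 <= k < N) (if `[< A k%:Z >] then fine (mu [set k%:Z]) else 0))
    @ \oo --> fine (mu A).
Proof.
move=> neg0.
pose F N := A `&` [set k : int | 0 <= k] `&` [set k | (`|k| < N)%N].
have -> : mu A = mu (\bigcup_N F N).
  have -> : A = (\bigcup_N F N) `|` (A `&` [set k | k < 0]).
    apply/seteqP; split => [k Ak|k [[N _ [[]]]|[]]]//=.
    have [k0|k0] := ltP k 0; [by right|left].
    by exists `|k|.+1; split=> /=.
  rewrite measureU//.
    rewrite [X in (_ + X)%E](_ : _ = 0%E) ?adde0//.
    by apply: (subset_measure0 _ _ _ neg0) => // k [].
  by rewrite -subset0 => k [[N _ [[_ /= k0 _]]] [_ /=]]; rewrite ltNge k0.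
under eq_fun do rewrite -measure_int_segment.
suff : mu \o F @ \oo --> (fine (mu (\bigcup_N F N)))%:E.
  exact: fine_cvg.
rewrite fineK ?fin_num_measure//; apply: nondecreasing_cvg_mu => // m n mn.
apply/subsetPset => k [? /= km]; split=> //=; exact: leq_trans km mn.
Qed.

(** For each event the difference of probabilities is a limit of partial sums of point-mass
    differences, to which the triangle inequality applies. *)
Lemma dTV_le (mu nu : probability int R) (B : R) :
  mu [set k | k < 0] = 0%E -> nu [set k | k < 0] = 0%E ->
  (forall N, \sum_(0 <= k < N)
    `|fine (mu [set k%:Z]) - fine (nu [set k%:Z])| <= B) ->
  dTV mu nu <= B.
Proof.
move=> mu0 nu0 le_B; apply: ge_sup;
  first by exists `|fine (mu set0) - fine (nu set0)|, set0.
move=> _ [A _ <-].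
apply: (cvgr_to_le (cvg_norm (cvgB (cvg_measure_int (A := A) mu0)
  (cvg_measure_int (A := A) nu0)))).
apply: nearW => N /=; apply: le_trans (le_B N).
rewrite !fctE -sumrB (le_trans (ler_norm_sum _ _ _))//; apply: ler_sum => k _.
by case: ifPn; rewrite ?subrr ?normr0.
Qed.

End laws_on_integers.

(** * The Poisson sums: independence and convolution *)

Section poisson_family.
Context {R : realType} (theta : R) (theta_gt0 : 0 < theta).
Context d (T : measurableType d) (P : probability T R)
  (Z : nat -> {RV P >-> nat}).
Hypothesis ZP : forall j, (1 <= j)%N -> poisson_rv (Z j) (j%:R^-1 * theta).
Hypothesis ZI : independent_RVs [set j : nat | (1 <= j)%N] Z.
Variable a : nat.
Implicit Types (n N j : nat) (k : int).

Let W n : {mfun T >-> int} := weighted_sum Z a n.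
Let p n k : R := fine (P (W n @^-1` [set k])).
Let q j i : R := fine (P (Z j @^-1` [set i])).

Lemma measurable_preZ j (B : set nat) : measurable (Z j @^-1` B).
Proof. by rewrite -[X in measurable X]setTI; exact: measurable_funP. Qed.

Lemma measurable_preW n (B : set int) : measurable (W n @^-1` B).
Proof. by rewrite -[X in measurable X]setTI; exact: measurable_funP. Qed.

Lemma poisson_rv_pmf j i : (0 < j)%N ->
  q j i = (j%:R^-1 * theta) ^+ i / i`!%:R * expR (- (j%:R^-1 * theta)).
Proof.
move=> j0; have r0 : 0 < j%:R^-1 * theta by rewrite mulr_gt0// invr_gt0 ltr0n.
rewrite /q; have := ZP j0 [set i]; rewrite /distribution /pushforward => ->.
by rewrite /poisson_prob r0 esum_set1 ?lee_fin ?poisson_pmf_ge0//=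
  /poisson_pmf r0.
Qed.

(** Stein's identity for one Poisson variable, as [stein_recursion_convolution] takes it. *)
Lemma poisson_rv_pmfS j i : (0 < j)%N ->
  j%:R * (i.+1%:R * q j i.+1) = theta * q j i.
Proof.
move=> j0; rewrite !poisson_rv_pmf// exprS factS natrM; field.
by rewrite !pnatr_eq0 -!lt0n j0 fact_gt0/= nat1r pnatr_eq0.
Qed.

Lemma weighted_sumS n x : (a <= n)%N -> W n.+1 x = W n x + (n.+1 * Z n.+1 x)%:Z.
Proof. by move=> an; rewrite /W/= /weighted_sum big_nat_recr. Qed.

Lemma weighted_sum_id x : W a x = 0.
Proof. by rewrite /W/= /weighted_sum big_geq. Qed.

Lemma weighted_sum_ge0 n x : 0 <= W n x.
Proof. by rewrite /W/= /weighted_sum sumr_ge0. Qed.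

(** Finite cylinders in the coordinates beyond [n]: a class to which the product formula applies
    directly, and which absorbs the coordinate [n.+1] when [n.+1] is lowered to [n]. *)
Definition tail_event n (E : set T) : Prop :=
  exists (J : {fset nat}) (A : nat -> set nat),
    [set` J] `<=` [set j | (n < j)%N] /\
    E = \bigcap_(j in [set` J]) (Z j @^-1` A j).

Lemma tail_eventT n : tail_event n setT.
Proof.
exists fset0, (fun=> setT).
by split=> [j|]; rewrite ?set_fset0// bigcap_set0.
Qed.

Lemma measurable_tail_event n E : tail_event n E -> measurable E.
Proof.
move=> [J [A [_ ->]]]; apply: fin_bigcap_measurable => [|j _];
  first exact: finite_fset.
exact: measurable_preZ.
Qed.

Lemma tail_eventS n E i : tail_event n.+1 E ->
  tail_event n (Z n.+1 @^-1` [set i] `&` E) /\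
  P (Z n.+1 @^-1` [set i] `&` E) = (P (Z n.+1 @^-1` [set i]) * P E)%E.
Proof.
move=> [J [A [Jn EA]]].
have nJ : n.+1 \notin J by apply/negP => /Jn /=; rewrite ltnn.
pose A' j := if j == n.+1 then [set i] else A j.
have A'J j : j \in J -> A' j = A j.
  by move=> jJ; rewrite /A'; case: eqP => // jn; rewrite -jn jJ in nJ.
have EA' : Z n.+1 @^-1` [set i] `&` E
    = \bigcap_(j in [set` (n.+1 |` J)%fset]) (Z j @^-1` A' j).
  rewrite EA; apply/seteqP; split => [x [/= xi xE] j /=|x xE].
    rewrite !inE => /orP[/eqP->|jJ]; first by rewrite /A' eqxx.
    by rewrite A'J//; exact: xE.
  split=> [|j /= jJ]; first by have := xE n.+1; rewrite /A' /= eqxx; apply;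
    rewrite !inE eqxx.
  by rewrite -A'J//; apply: xE; rewrite /= !inE jJ orbT.
split.
  exists (n.+1 |` J)%fset, A'; split=> // j /=.
  by rewrite !inE => /orP[/eqP->//|/Jn /=]; exact: ltnW.
rewrite EA' ZI//; last first.
  by move=> j /=; rewrite !inE => /orP[/eqP->//|/Jn /=]; lia.
rewrite big_fsetU1//= {1}/A' eqxx; congr (_ * _)%E.
rewrite EA ZI//; last by move=> j /Jn /=; lia.
by rewrite big_seq [RHS]big_seq; apply: eq_bigr => j jJ; rewrite A'J.
Qed.

Lemma weighted_sumS_pre n k i : (a <= n)%N ->
  W n.+1 @^-1` [set k] `&` Z n.+1 @^-1` [set i]
    = W n @^-1` [set k - (n.+1 * i)%:Z] `&` Z n.+1 @^-1` [set i].
Proof.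
move=> an; apply/seteqP; split=> x [/= xk xi]; move: xk;
  rewrite weighted_sumS// xi => xk; split=> //.
  by rewrite -xk addrK.
by rewrite -(subrK (n.+1 * i)%:Z k); congr (_ + _).
Qed.

Lemma measure_weighted_sumS n k N E : (a <= n)%N -> k < N%:Z -> measurable E ->
  P (W n.+1 @^-1` [set k] `&` E)
    = (\sum_(0 <= i < N) P (W n @^-1` [set (k - (n.+1 * i)%:Z)%R]
                            `&` (Z n.+1 @^-1` [set i] `&` E)))%E.
Proof.
move=> an kN mE.
under eq_bigr do rewrite setIA -weighted_sumS_pre// -setIA
  [X in _ `&` X]setIC setIA.
rewrite -measure_partition_nat//; last by apply: measurableI => //;
  exact: measurable_preW.
(* The restriction [Z n.+1 < N] is automatic: [W n] is nonnegative, so a larger value would push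
   [W n.+1] above [k]. *)
congr (P _); apply/esym/setIidPl => x [/= + _]; rewrite weighted_sumS// => xk.
have := weighted_sum_ge0 n x; nia.
Qed.

(** By induction from the constant [W a]: split on the value of [Z n.+1], move that condition into
    the tail event, and use independence at [n]. *)
Lemma weighted_sum_tail n k E : (a <= n)%N -> tail_event n E ->
  P (W n @^-1` [set k] `&` E) = (P (W n @^-1` [set k]) * P E)%E.
Proof.
move=> /subnK <-; elim: (n - a)%N k E => {n} [|m ih] k E tE.
  rewrite add0n; have [->|k0] := eqVneq k 0.
    rewrite (_ : _ @^-1` _ = setT) ?setTI ?probability_setT ?mul1e//.
    by apply/seteqP; split=> x //= _; exact: weighted_sum_id.
  rewrite (_ : _ @^-1` _ = set0) ?set0I ?measure0 ?mul0e// -subset0 => x /= xk.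
  by move: k0; rewrite -xk [_ x]weighted_sum_id eqxx.
rewrite addSn in tE *; set n := (m + a)%N in tE *.
have an : (a <= n)%N by exact: leq_addl.
have kN : k < `|k|.+1%:Z by lia.
rewrite -[W n.+1 @^-1` _ in RHS]setIT !(measure_weighted_sumS an kN)//;
  last first.
  exact: measurable_tail_event tE.
rewrite ge0_sume_distrl//; apply: eq_bigr => i _.
have [tE' ZE] := tail_eventS i tE;
  have [tT _] := tail_eventS i (tail_eventT n.+1).
by rewrite !ih// ZE setIT muleA.
Qed.

Lemma law_convolution n k N : (a <= n)%N -> k < N%:Z ->
  p n.+1 k = \sum_(0 <= i < N) p n (k - (n.+1 * i)%:Z) * q n.+1 i.
Proof.
move=> an kN; rewrite /p -[_ @^-1` _ in LHS]setIT (measure_weighted_sumS an kN)//.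
rewrite -sum_fine; last by move=> i _; rewrite fin_num_measure//;
  do 2?apply: measurableI;
  rewrite ?setIT//; [exact: measurable_preW|exact: measurable_preZ].
apply: eq_bigr => i _; have [tT _] := tail_eventS i (tail_eventT n.+1).
rewrite weighted_sum_tail// setIT fineM// fin_num_measure//.
  exact: measurable_preW.
exact: measurable_preZ.
Qed.

(** * Stein's recursion and bounds for the law of the sum *)

Lemma law_ge0 n k : 0 <= p n k.
Proof. by rewrite fine_ge0. Qed.

Lemma law_lt0 n k : k < 0 -> p n k = 0.
Proof.
move=> k0; rewrite /p (_ : _ @^-1` _ = set0) ?measure0// -subset0 => x /= xk.
by move: k0; rewrite -xk ltNge [X in ~~ X]weighted_sum_ge0.
Qed.

Lemma law_sum_le1 n N : \sum_(0 <= k < N) p n k%:Z <= 1.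
Proof.
rewrite (eq_bigr (fun k : nat =>
  if `[< (setT : set int) k%:Z >]
  then fine (distribution P (W n) [set k%:Z]) else 0)).
  by rewrite -measure_int_segment -lee_fin fineK
    ?fin_num_measure// probability_le1.
by move=> k _; rewrite asboolT.
Qed.

(** The law at [n = a] is the unit mass at [0], which satisfies the recursion with empty window;
    each further variable is one convolution step. *)
Lemma law_stein n : (a <= n)%N -> stein_recursion (p n) theta a n.
Proof.
move=> /subnK <-; elim: (n - a)%N => {n} [|m ih].
  move=> k; rewrite add0n big_geq// mulr0; have [->|k0] := eqVneq k 0.
    by rewrite mul0r.
  rewrite /p (_ : _ @^-1` _ = set0) ?measure0 ?mulr0// -subset0 => x /= xk.
  by move: k0; rewrite -xk [_ x]weighted_sum_id eqxx.
rewrite addSn; apply: (stein_recursion_convolution _ ih) => [|k N|i].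
- exact: leq_addl.
- by apply: law_convolution; exact: leq_addl.
- exact: poisson_rv_pmfS.
Qed.

(* For [k <= x], the event [W n = k] forces [Z j = 0] for [x < j <= n], and each
   [j] contributes a factor [expR (- (theta / j)) <= (j / j.+1) `^ theta]. *)
Lemma law_cumulative_le x n : (a <= x <= n)%N ->
  (\sum_(0 <= k < x.+1) p n k%:Z) * n.+1%:R `^ theta <= x.+1%:R `^ theta.
Proof.
move=> /andP[ax /subnK <-]; elim: (n - x)%N => {n} [|m ih].
  by rewrite add0n ler_piMl ?powR_ge0// law_sum_le1.
rewrite addSn; apply: le_trans ih; set n := (m + x)%N.
have an : (a <= n)%N by rewrite (leq_trans ax)// leq_addl.
rewrite (eq_big_nat _ _ (F2 := fun k : nat => p n k%:Z * q n.+1 0)); last first.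
  move=> k /andP[_ kx]; rewrite (law_convolution (N := x.+1) an); last by lia.
  rewrite big_nat_recl// muln0 subr0 big_nat big1 ?addr0// => i _.
  by rewrite law_lt0 ?mul0r//; rewrite /n; nia.
rewrite -mulr_suml -mulrA ler_wpM2l ?sumr_ge0//; first by move=> k _;
  exact: law_ge0.
by rewrite poisson_rv_pmf// expr0 fact0 divr1 mul1r expRN_le_powR// ltW.
Qed.

Lemma law_cumulative_le_powR x n : (0 < n)%N -> (a <= x <= n)%N ->
  \sum_(0 <= k < x.+1) p n k%:Z <= x.+1%:R `^ theta / n%:R `^ theta.
Proof.
move=> n0 axn; have nth0 : 0 < (n%:R : R) `^ theta by rewrite powR_gt0// ltr0n.
rewrite ler_pdivlMr//; apply: le_trans (law_cumulative_le axn).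
rewrite ler_wpM2l ?sumr_ge0//; first by move=> k _; exact: law_ge0.
by rewrite ge0_ler_powR ?nnegrE ?(ltW theta_gt0)// ler_nat.
Qed.

(** [stein_pointwise] meets the cumulative bound at [x = k - 1]. The exponent [theta - 1 - 1] fits
    [sum_powR_le] at [s = theta - 1]. *)
Lemma law_div_le n (k : nat) : (a < k <= n)%N ->
  p n k%:Z / k%:R <= theta * (k%:R `^ (theta - 1 - 1) / n%:R `^ theta).
Proof.
move=> /andP[ak kn]; have k0 : (0 < k)%N by lia.
have kR : 0 < k%:R :> R by rewrite ltr0n.
have n0 : (0 < n)%N by lia.
have cum : \sum_(0 <= j < k) p n j%:Z <= k%:R `^ theta / n%:R `^ theta.
  by have := @law_cumulative_le_powR k.-1 n n0; rewrite prednK//; apply; lia.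
rewrite !powR_pred// ler_pdivrMr//.
rewrite (_ : theta * _ * _ = theta * (k%:R `^ theta / n%:R `^ theta) / k%:R);
  last first.
  by field; rewrite !gt_eqF// powR_gt0// ltr0n.
have an : (a <= n)%N by lia.
rewrite ler_pdivlMr// mulrC.
apply: le_trans (stein_pointwise (ltW theta_gt0) (law_ge0 n) (@law_lt0 n)
  (law_stein an) k0 an) _.
by rewrite ler_wpM2l// ltW.
Qed.

Lemma dTV_weighted_sum_shift n : (a < n)%N ->
  dTV (distribution P (weighted_sum Z a n))
      (distribution P (shift1 (weighted_sum Z a n)))
  <= (2 * theta + 2) * (a.+1%:R `^ theta / n%:R `^ theta
      + theta * ((\sum_(a.+1 <= k < n.+1) k%:R `^ (theta - 1 - 1))
                 / n%:R `^ theta)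
      + n%:R^-1).
Proof.
move=> an; have th0 := ltW theta_gt0.
apply: dTV_le => [||N].
- change (P (W n @^-1` [set k | k < 0]) = 0%E).
  rewrite (_ : _ @^-1` _ = set0) ?measure0// -subset0 => x /=.
  by rewrite ltNge [X in ~~ X]weighted_sum_ge0.
- change (P (shift1 (W n) @^-1` [set k | k < 0]) = 0%E).
  rewrite (_ : _ @^-1` _ = set0) ?measure0// -subset0 => x /=.
  by rewrite ltNge /shift1 addr_ge0// weighted_sum_ge0.
rewrite (eq_bigr (fun k : nat => `|p n k%:Z - p n (k%:Z - 1)|)); last first.
  move=> k _; congr (`|_ - fine (P _)|).
  apply/seteqP; split=> x /= xk; first by rewrite -xk /shift1 addrK.
  by rewrite /shift1 -(subrK 1 k%:Z); congr (_ + _).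
apply: le_trans (stein_total_variation N th0 an (law_ge0 n) (@law_lt0 n)
  (law_sum_le1 n) (law_stein (ltnW an))) _.
rewrite ler_wpM2l ?addr_ge0 ?mulr_ge0// lerD2r lerD//.
  (* The mass at [0] is bounded by the cumulative sum up to [x = a]. *)
  apply: le_trans (law_cumulative_le_powR _ _); [|lia..].
  by rewrite big_ltn// lerDl sumr_ge0// => k _; exact: law_ge0.
rewrite mulr_suml mulr_sumr; apply: ler_sum_nat => k /andP[ak kn].
by apply: law_div_le; lia.
Qed.

End poisson_family.

(** * The bounds for the two cases of [theta] *)

Theorem theorem3p1 (R : realType) (theta : R) (theta_gt0 : 0 < theta) :
  (theta != 1 ->
   exists C : R, forall (d : measure_display) (T : measurableType d)
     (P : probability T R) (Z : nat -> {RV P >-> nat}),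
     (forall j : nat, (1 <= j)%N -> poisson_rv (Z j) (j%:R^-1 * theta)) ->
     independent_RVs [set j : nat | (1 <= j)%N] Z ->
     forall a n : nat, (a < n)%N ->
       dTV (distribution P (weighted_sum Z a n))
           (distribution P (shift1 (weighted_sum Z a n)))
       <= C * ((a.+1%:R / n%:R) `^ theta + n%:R^-1))
  /\
  (theta = 1 ->
   exists C : R, forall (d : measure_display) (T : measurableType d)
     (P : probability T R) (Z : nat -> {RV P >-> nat}),
     (forall j : nat, (1 <= j)%N -> poisson_rv (Z j) (j%:R^-1 * theta)) ->
     independent_RVs [set j : nat | (1 <= j)%N] Z ->
     forall a n : nat, (a < n)%N ->
       dTV (distribution P (weighted_sum Z a n))
           (distribution P (shift1 (weighted_sum Z a n)))
       <= C * (a.+1%:R / n%:R + n%:R^-1 * ln (n%:R / a.+1%:R))).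
Proof.
have th0 := ltW theta_gt0; split=> [theta1|theta1].
  have s0 : theta - 1 != 0 by rewrite subr_eq0.
  have [C C0 le_C] := sum_powR_le s0.
  (* Divided by [n]^ theta[, the two powers from]sum_powR_le[are at most](a.+1 / n) [^ theta] and
     equal to [1 / n], respectively. *)
  exists ((2 * theta + 2) * (1 + theta * C)) => d T P Z ZP ZI a n an.
  apply: le_trans (dTV_weighted_sum_shift theta_gt0 ZP ZI an) _.
  have n0 : 0 < n%:R :> R by rewrite ltr0n; lia.
  have nth0 : 0 < (n%:R : R) `^ theta by rewrite powR_gt0.
  rewrite powR_divM// -[leRHS]mulrA ler_wpM2l ?addr_ge0
    ?mulr_ge0// mulrDl mul1r -addrA addrCA addrC lerD2l.
  rewrite -mulrA ler_wpM2l// ler_pdivrMr//; apply: le_trans (le_C _ _ an) _.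
  rewrite -mulrA ler_wpM2l// mulrDl lerD//.
    by rewrite divfK ?gt_eqF// ler_powR// ?ler1n// gerBl.
  by rewrite powR_pred; [rewrite mulrC|rewrite -(ltr0n R)].
(* Besides the ratio [a.+1 / n] and the logarithmic term, two copies of [1 / n] occur, each at most
   that ratio; [4] covers them all. *)
exists ((2 * theta + 2) * 4) => d T P Z ZP ZI a n an.
have a0 : 0 < a.+1%:R :> R by rewrite ltr0n.
have n0 : 0 < n%:R :> R by rewrite ltr0n; lia.
apply: le_trans (dTV_weighted_sum_shift theta_gt0 ZP ZI an) _.
rewrite -[leRHS]mulrA ler_wpM2l ?addr_ge0 ?mulr_ge0//.
rewrite theta1 mul1r !powRr1 ?divr_ge0// subrr sub0r.
under eq_bigr do rewrite powR_inv1//.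
have n_le : n%:R^-1 <= a.+1%:R / n%:R :> R.
  by rewrite ler_peMl ?invr_ge0// ler1n.
have ratio0 : 0 <= a.+1%:R / n%:R :> R by rewrite divr_ge0.
have ln0 : 0 <= n%:R^-1 * ln (n%:R / a.+1%:R) :> R.
  by rewrite mulr_ge0 ?invr_ge0// ln_ge0// ler_pdivlMr// mul1r ler_nat.
have harm : (\sum_(a.+1 <= k < n.+1) k%:R^-1) / n%:R
    <= n%:R^-1 + n%:R^-1 * ln (n%:R / a.+1%:R) :> R.
  rewrite mulrC -[X in X + _]mulr1 -mulrDr ler_wpM2l ?invr_ge0//.
  apply: le_trans (sum_harmonic_le an) _.
  by rewrite lerD2r invf_le1// ler1n.
lra.
Qed.
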